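(* For every prime $p$ and every integer $k \geq 1$ there is an integer $N$ such that, if $M$ is a simple $\mathrm{GF}(p)$-representable matroid with rank at least $N$, then for any $2$-colouring of the points of $M$ there is a monochromatic rank-$k$ flat of $M$.
   Context: Matroids are finite. $\mathrm{GF}(p)$ is the field with $p$ elements. A point of a matroid is a rank-$1$ flat; in a simple matroid the points correspond to the elements of the ground set. A flat is monochromatic if all points it contains have the same colour. *)

(* Defs.v *)
From HB Require Import structures.
From mathcomp Require Import all_boot all_order all_algebra.

Set Implicit Arguments.
Unset Strict Implicit.
Unset Printing Implicit Defensive.

Record matroid (E : finType) := Matroid {
  indep : pred {set E};
  indep0 : indep set0;
  indepS : forall I J : {set E}, J \subset I -> indep I -> indep J;
  indep_augment : forall I J : {set E}, indep I -> indep J -> #|I| < #|J| ->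
    exists2 e, e \in J :\: I & indep (e |: I)
}.

Section MatroidTheory.

Variables (E : finType) (M : matroid E).

Definition mrank (A : {set E}) : nat :=
  \max_(I : {set E} | (I \subset A) && indep M I) #|I|.

Definition matroid_rank : nat := mrank [set: E].

Definition mclosure (A : {set E}) : {set E} :=
  [set e | mrank (e |: A) == mrank A].

Definition is_flat (A : {set E}) : bool := mclosure A == A.

Definition is_rank_flat (k : nat) (A : {set E}) : bool :=
  is_flat A && (mrank A == k).

(* No loops ([e = f]) and no parallel pairs ([e != f]). *)
Definition simple_matroid : Prop := forall e f : E, indep M [set e; f].

(* [free] is applied to the family indexed by [I], not to its set of values:
   two elements represented by the same vector are dependent. *)
Definition representable (F : fieldType) : Prop :=
  exists (n : nat) (v : E -> 'cV[F]_n),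
    forall I : {set E}, indep M I = free [seq v e | e <- enum I].

Definition point : Type := {P : {set E} | is_rank_flat 1 P}.

Definition monochromatic (C : Type) (c : point -> C) (A : {set E}) : Prop :=
  forall P Q : point, val P \subset A -> val Q \subset A -> c P = c Q.

End MatroidTheory.

(* Main.v *)
Require Import Defs.
From mathcomp Require Import all_boot all_order all_algebra ring.
From Stdlib Require Import Classical_Prop.

(* Assume that no rank-[k] flat is monochromatic.  Then any [k] independent
   elements of the same colour have a combination that is an element of another
   colour, and this combination involves at least two of them.  Iterating this
   over disjoint blocks of a basis yields elements with arbitrarily large
   support; after a product Ramsey argument each basis vector in the support can
   be exchanged for a second one, which produces a large monochromatic cube
   [y + sum_j c_j d_j] with all [c_j] in a two-element set [D].

   Applying the assumption to [k] points of a cube, the combining coefficients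
   [a] depend on the chosen points only; by Hales-Jewett they are constant on a
   combinatorial subspace, which is a monochromatic cube over the sumset
   [a_1 D + ... + a_k D].  Over a prime field this sumset is larger than [D], so
   eventually [D] is the whole field and the cube is an affine geometry.

   Every [k]-dimensional space of directions of this affine geometry contains an
   element (otherwise it spans a monochromatic flat with a base point), so the
   elements at infinity have large rank and the argument can be repeated there.
   This gives vectors [y_1, ..., y_r] such that the colour of a combination
   depends only on the index of its first nonzero coefficient; by the pigeonhole
   principle [k] of them span a monochromatic projective geometry, a
   contradiction. *)

Set Implicit Arguments.
Unset Strict Implicit.
Unset Printing Implicit Defensive.

(** * Hales-Jewett and product Ramsey theorems *)

Definition fill (T : Type) (a : T) (w : seq (option T)) : seq T :=
  map (odflt a) w.

Lemma fill_Some (T : Type) (a : T) (s : seq T) : fill a (map Some s) = s.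
Proof. by rewrite /fill -map_comp map_id. Qed.

Definition const_line (T : finType) (C : Type) (L : seq T) (chi : seq T -> C)
    (w : seq (option T)) :=
  {in L &, forall a b, chi (fill a w) = chi (fill b w)}.

(* Only the letters of [L] have to agree on the line, whereas its fixed letters
   are arbitrary: this is what allows an induction on [L]. *)
Definition hj_at (T : finType) (L : seq T) := forall C : finType,
  exists n, forall chi : seq T -> C,
    exists w, [/\ size w = n, None \in w & const_line L chi w].

(* The lines [ws] are focused at [f]: they share their point at the new letter
   [x], and their colours at the old letters are pairwise distinct. *)
Lemma color_focusing (T : finType) (x a0 : T) (L : seq T) :
    a0 \in L -> hj_at L ->
  forall (C : finType) (s : nat), exists n, forall chi : seq T -> C,
    (exists w, [/\ size w = n, None \in w & const_line (x :: L) chi w]) \/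
    exists ws f, [/\ size ws = s, size f = n,
      forall w, w \in ws ->
        [/\ size w = n, None \in w, fill x w = f & const_line L chi w]
      & uniq [seq chi (fill a0 w) | w <- ws]].
Proof.
move=> La0 HL C; elim=> [|s [n IH]].
  by exists 0 => chi; right; exists [::], [::].
(* A prefix is coloured by the colouring it induces on all continuations of length [n], so the
   letters of [L] become interchangeable on [w1]. *)
have [n' Hn'] := HL {ffun n.-tuple T -> C}.
exists (n' + n) => chi.
have [w1 [sz1 None1 line1]] :=
  Hn' (fun u => [ffun v : n.-tuple T => chi (u ++ v)]).
have lineE a v : a \in L -> size v = n ->
    chi (fill a w1 ++ v) = chi (fill a0 w1 ++ v).
  move=> La /eqP szv.
  by have /ffunP/(_ (Tuple szv)) := line1 _ _ La La0; rewrite !ffunE.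
have szf (a : T) w : size (fill a w) = size w by rewrite size_map.
have fill_cat (a : T) u v : fill a (u ++ v) = fill a u ++ fill a v.
  exact: map_cat.
have mono w : size w = n -> None \in w ->
    const_line (x :: L) (fun v => chi (fill a0 w1 ++ v)) w ->
  exists w, [/\ size w = n' + n, None \in w & const_line (x :: L) chi w].
  move=> szw Nw linew; exists (map Some (fill a0 w1) ++ w); split.
  - by rewrite size_cat size_map szf sz1 szw.
  - by rewrite mem_cat Nw orbT.
  by move=> a b La Lb; rewrite !fill_cat !fill_Some; apply: linew.
case: (IH (fun v => chi (fill a0 w1 ++ v))) => [[w [szw Nw linew]]|].
  by left; apply: mono linew.
move=> [ws [f [szws sf Hws uws]]].
(* If the focus repeats the colour of a line, that line is constant at [x] too. Otherwise [w1]
   followed by the fixed word [f] is one more line, and the old lines move together with [w1] to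
   keep a common focus. *)
case: (boolP (chi (fill a0 w1 ++ f) \in
              [seq chi (fill a0 w1 ++ fill a0 w) | w <- ws])).
  case/mapP=> w wws fE; left; have [szw Nw fw linew] := Hws w wws.
  apply: (mono w) => // a b; rewrite !inE.
  have linex c : c \in L -> chi (fill a0 w1 ++ fill c w) = chi (fill a0 w1 ++ f).
    by move=> Lc; rewrite fE; apply: linew.
  case/predU1P=> [->|La] /predU1P [->|Lb] //.
  - by rewrite fw linex.
  - by rewrite fw linex.
  by apply: linew.
move=> fN; right.
exists ((w1 ++ map Some f) :: [seq w1 ++ w | w <- ws]), (fill x w1 ++ f); split.
- by rewrite /= size_map szws.
- by rewrite size_cat szf sz1 sf.
- move=> w; rewrite inE => /predU1P [-> | /mapP [v vws ->]].
    split.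
    + by rewrite size_cat size_map sz1 sf.
    + by rewrite mem_cat None1.
    + by rewrite fill_cat fill_Some.
    by move=> a b La Lb; rewrite !fill_cat !fill_Some !lineE.
  have [szv Nv fv linev] := Hws v vws; split.
  + by rewrite size_cat sz1 szv.
  + by rewrite mem_cat None1.
  + by rewrite fill_cat fv.
  by move=> a b La Lb; rewrite !fill_cat !lineE ?szf //; apply: linev.
rewrite /= fill_cat fill_Some -map_comp.
rewrite (eq_map (g := fun w => chi (fill a0 w1 ++ fill a0 w))) ?fN //.
by move=> w /=; rewrite fill_cat.
Qed.

(** More than [#|C|] focused lines cannot have pairwise distinct colours. A one-letter [L] is
    treated apart because focusing needs an old letter [a0]. *)
Theorem hales_jewett (T : finType) (L : seq T) : hj_at L.
Proof.
elim: L => [|x L IH] C.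
  by exists 1 => chi; exists [:: None].
case: L IH => [|a0 L] IH.
  exists 1 => chi; exists [:: None]; split=> // a b.
  by rewrite !inE => /eqP-> /eqP->.
have [n Hn] := color_focusing x (mem_head a0 L) IH C #|C|.+1.
exists n => chi; case: (Hn chi) => // [[ws [f [szws _ _ /card_uniqP]]]].
rewrite size_map szws => cardE.
by have := max_card [in [seq chi (fill a0 w) | w <- ws]]; rewrite cardE ltnn.
Qed.

Definition select (P : seq (nat * nat)) (h : nat -> bool) : seq nat :=
  mkseq (fun i => let q := nth (0, 0) P i in if h i then q.2 else q.1) (size P).

(** Induction on [d]: [M] exceeds the number of colourings of the tails with entries below [N], so
    two first entries [x < y] induce the same one; the induction hypothesis is then applied with [x]
    fixed. *)
Lemma grid_pigeonhole (d : nat) (C : finType) : exists N,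
  forall chi : seq nat -> C, exists P : seq (nat * nat),
    [/\ size P = d, all (fun q => q.1 < q.2 < N) P
      & forall h h', chi (select P h) = chi (select P h')].
Proof.
elim: d => [|d [N IH]]; first by exists 0 => chi; exists [::].
pose M := #|{ffun d.-tuple 'I_N -> C}|.+1.
exists (maxn N M) => chi.
pose f (x : 'I_M) := [ffun t : d.-tuple 'I_N => chi (val x :: map val t)].
have /injectivePn [x [y neq_xy fxy]] : ~~ injectiveb f.
  apply/negP=> /injectiveP/leq_card; by rewrite card_ord ltnn.
wlog lt_xy : x y neq_xy fxy / x < y.
  move=> W; case: (ltngtP x y) => [|/W|/val_inj] //.
    exact: W.
  - by apply=> //; rewrite eq_sym.
  by move=> e; rewrite e eqxx in neq_xy.
have [P [szP ltPN constP]] := IH (fun s => chi (val x :: s)).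
exists ((val x, val y) :: P); split.
- by rewrite /= szP.
- rewrite /= lt_xy /= leq_max ltn_ord orbT /=.
  apply: sub_all ltPN => q /andP [-> lt2] /=.
  by rewrite leq_max lt2.
have selE h : chi (select ((val x, val y) :: P) h) =
              chi (val x :: select P (fun i => h i.+1)).
  rewrite /select /mkseq /= (iotaDl 1 0) -map_comp /=.
  set s := map _ (iota 0 (size P)).
  have -> : s = select P (fun i => h i.+1) by [].
  case: (h 0) => //.
  have lts : all (fun i => i < N) (select P (fun i => h i.+1)).
    apply/allP => i /mapP [j]; rewrite mem_iota add0n => /andP [_ ltj] ->.
    have /andP [lt1 lt2] := allP ltPN _ (mem_nth (0, 0) ltj).
    by rewrite /=; case: (h j.+1) => //; apply: ltn_trans lt2.
  have [t tE] : exists t : seq 'I_N, map val t = select P (fun i => h i.+1).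
    exists (pmap insub (select P (fun i => h i.+1))).
    rewrite pmap_filter; last by move=> i; rewrite insubK.
    apply/all_filterP; apply: sub_all lts => i lti.
    by rewrite insubT.
  have szt : size t == d by rewrite -(size_map val) tE size_mkseq szP.
  move/ffunP/(_ (Tuple szt)): fxy; rewrite !ffunE /= tE. by [].
by move=> h h'; rewrite !selE; apply: constP.
Qed.

Lemma card_fiber (T C : finType) (f : T -> C) (k : nat) :
  k * #|C| < #|T| -> exists c, exists s : 'I_k -> T,
    injective s /\ forall i, f (s i) = c.
Proof.
move=> ltT; have [c ltc] : exists c, k <= #|[pred x | f x == c]|.
  apply/existsP; apply: contraLR ltT; rewrite -leqNgt => /existsPn H.
  rewrite -sum1_card (partition_big f predT) //= mulnC -sum_nat_const.
  apply: leq_sum => c _; rewrite sum1_card; apply: ltnW.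
  by have := H c; rewrite -ltnNge.
exists c, (fun i => enum_val (widen_ord ltc i)); split.
  by move=> i j /enum_val_inj /(congr1 val) /= /val_inj.
by move=> i; have := enum_valP (widen_ord ltc i); rewrite inE => /eqP.
Qed.

Import GRing.Theory.
Local Open Scope ring_scope.

(** * Colourings of vector spaces *)

Section ColouredSpaces.

Variables (F : finFieldType) (C : finType) (k : nat).

Definition lin_indep (V : lmodType F) (I : finType) (u : I -> V) :=
  forall a : I -> F, \sum_i a i *: u i = 0 -> forall i, a i = 0.

(* A vector has colour [None] if it represents no element of the matroid. *)
Definition projective (V : lmodType F) (chi : V -> option C) :=
  chi 0 = None /\ forall s v, s != 0 -> chi (s *: v) = chi v.

(** The [u i] have to be coloured so that the elements in their span have rank [k]; other vectors of
    the span may represent no element. *)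
Definition mono_flat (V : lmodType F) (chi : V -> option C) :=
  exists (u : 'I_k -> V) (c : C), [/\ lin_indep u, forall i, chi (u i) = Some c
    & forall a : 'I_k -> F, chi (\sum_i a i *: u i) \in [:: None; Some c]].

Definition lin_inj (V W : lmodType F) (L : V -> W) :=
  (forall a u v, L (a *: u + v) = a *: L u + L v) /\ forall u, L u = 0 -> u = 0.

Lemma lin_inj0 (V W : lmodType F) (L : V -> W) : lin_inj L -> L 0 = 0.
Proof.
by case=> linL _; have := linL (-1) 0 0; rewrite scaler0 addr0 scaleN1r addNr.
Qed.

Lemma lin_inj_sum (V W : lmodType F) (L : V -> W) (I : finType) (a : I -> F)
    (u : I -> V) :
  lin_inj L -> L (\sum_i a i *: u i) = \sum_i a i *: L (u i).
Proof.
move=> LL; have [linL _] := LL.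
apply: (big_rec2 (fun x y => L x = y)) => [|i x y _ <-].
  exact: lin_inj0.
exact: linL.
Qed.

Lemma lin_inj_comp (U V W : lmodType F) (L : V -> W) (L' : U -> V) :
  lin_inj L -> lin_inj L' -> lin_inj (L \o L').
Proof.
move=> [linL injL] [linL' injL']; split=> [a u v|u] /=.
  by rewrite linL' linL.
by move/injL/injL'.
Qed.

Lemma mono_flat_pull (V W : lmodType F) (L : V -> W) (chi : W -> option C) :
  lin_inj L -> mono_flat (chi \o L) -> mono_flat chi.
Proof.
move=> LL [u [c [indu colu spanu]]]; exists (L \o u), c; split=> // a.
  rewrite -(lin_inj_sum _ _ LL) => /(proj2 LL); exact: indu.
by rewrite -(lin_inj_sum _ _ LL); apply: spanu.
Qed.

Lemma projective_pull (V W : lmodType F) (L : V -> W) (chi : W -> option C) :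
  lin_inj L -> projective chi -> projective (chi \o L).
Proof.
move=> LL [chi0 chiZ]; have L0 := lin_inj0 LL.
split=> [|s v s0] /=; first by rewrite L0.
have := proj1 LL s v 0; rewrite L0 !addr0 => ->; exact: chiZ.
Qed.

Lemma other_colour (V : lmodType F) (chi : V -> option C) (u : 'I_k -> V) c :
    ~ mono_flat chi -> lin_indep u -> (forall i, chi (u i) = Some c) ->
  exists (a : {ffun 'I_k -> F}) (c' : C),
    c' != c /\ chi (\sum_i a i *: u i) = Some c'.
Proof.
move=> nmono indu colu.
case: (boolP [forall a : {ffun 'I_k -> F},
                chi (\sum_i a i *: u i) \in [:: None; Some c]]) => [/forallP H|].
  case: nmono; exists u, c; split=> // a.
  have := H (finfun a).
  by under eq_bigr do rewrite ffunE.
case/forallPn=> a; case E : (chi _) => [c'|]; rewrite !inE //= => neq.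
by exists a, c'; split=> //; apply: contra neq => /eqP->.
Qed.

(** With a single nonzero coefficient the combination is a multiple of some [u i] and has colour
    [c]; with none it is zero and uncoloured. *)
Lemma two_nonzero (V : lmodType F) (chi : V -> option C) (u : 'I_k -> V)
    (a : 'I_k -> F) c c' :
    projective chi -> (forall i, chi (u i) = Some c) -> c' != c ->
    chi (\sum_i a i *: u i) = Some c' ->
  exists i j, [/\ i != j, a i != 0 & a j != 0].
Proof.
move=> [chi0 chiZ] colu neq E.
have [i ai] : exists i, a i != 0.
  apply/existsP; apply: contraTT isT => /existsPn H; move: E.
  rewrite big1 ?chi0 // => i _.
  by have := H i; rewrite negbK => /eqP->; rewrite scale0r.
case: (boolP [exists j, (i != j) && (a j != 0)]) => [/existsP [j /andP [ij aj]]|].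
  by exists i, j.
move=> /existsPn H; move: E; rewrite (bigD1 i) //= big1 ?addr0 => [|j ji].
  by rewrite chiZ // colu => -[e]; rewrite e eqxx in neq.
have := H j; rewrite eq_sym ji /= negbK => /eqP->; exact: scale0r.
Qed.

(** * Vectors of large support and the first cube *)

Lemma coord_sum (I J : finType) (a : I -> F) (u : I -> {ffun J -> F^o}) (x : J) :
  (\sum_i a i *: u i) x = \sum_i a i * u i x :> F.
Proof. by rewrite sum_ffunE; under eq_bigr do rewrite ffunE. Qed.

Definition unit_vec (I : finType) (i : I) : {ffun I -> F^o} :=
  [ffun j => (j == i)%:R].

Definition unit_coloured (I : finType) (chi : {ffun I -> F^o} -> option C) :=
  forall i, chi (unit_vec i) != None.

Definition supp (I : finType) (w : {ffun I -> F^o}) := [set i | w i != 0].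

(** A block of length [q ^ s.+1] splits into [q] blocks of length [q ^ s]. Of the vectors found in
    these, [k] share a colour; a combination of another colour involves two of them, whose supports
    are disjoint. *)
Lemma long_support N (chi : {ffun 'I_N -> F^o} -> option C) (s j : nat) :
    projective chi -> ~ mono_flat chi -> unit_coloured chi ->
    let q := (k * #|C|).+1 in (j.+1 * q ^ s <= N)%N ->
  exists w, [/\ chi w != None,
    forall i, i \in supp w -> (j * q ^ s <= i < j.+1 * q ^ s)%N
    & (s < #|supp w|)%N].
Proof.
move=> proj nmono ucol q; elim: s j => [|s IH] j leN.
  rewrite expn0 !muln1 in leN *.
  exists (unit_vec (Ordinal leN)); split; first exact: ucol.
    move=> i; rewrite inE ffunE => nz.
    suff /eqP -> : i == Ordinal leN by rewrite /= leqnn ltnSn.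
    by apply: contraNT nz => /negPf->.
  apply/card_gt0P; exists (Ordinal leN).
  by rewrite inE ffunE eqxx oner_eq0.
have lt_block (t : 'I_q) : ((j * q + t).+1 <= j.+1 * q)%N.
  by rewrite -addnS mulSn addnC leq_add2r.
have blockP (t : 'I_q) : exists w c, [/\ chi w = Some c,
    forall i, i \in supp w -> ((j * q + t) * q ^ s <= i < (j * q + t).+1 * q ^ s)%N
    & (s < #|supp w|)%N].
  case: (IH (j * q + t)%N) => [|w [colw suppw cardw]].
    apply: leq_trans leN; rewrite expnS mulnA leq_mul2r lt_block orbT //.
  by case E: (chi w) colw => [c|] // _; exists w, c.
have [w /fin_all_exists [col wP]] := fin_all_exists blockP.
have [c [sg [inj_sg sgP]]] : exists c, exists sg : 'I_k -> 'I_q,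
    injective sg /\ forall i, col (sg i) = c.
  by apply: card_fiber; rewrite card_ord.
pose u i := w (sg i).
have disj i i' x : x \in supp (u i) -> x \in supp (u i') -> i = i'.
  have [_ Hi _] := wP (sg i); have [_ Hi' _] := wP (sg i').
  move=> /Hi /andP [l1 r1] /Hi' /andP [l2 r2]; apply/inj_sg/val_inj/eqP.
  have q0 : (0 < q ^ s)%N by rewrite expn_gt0.
  have := leq_ltn_trans l1 r2; have := leq_ltn_trans l2 r1.
  rewrite !ltn_pmul2r // !ltnS !leq_add2l => l l'.
  by rewrite eqn_leq l l'.
have sumE (a : 'I_k -> F) i x : x \in supp (u i) ->
    (\sum_i a i *: u i) x = a i * u i x.
  move=> xi; rewrite coord_sum (bigD1 i) //= big1 ?addr0 // => i' ni.
  have: x \notin supp (u i').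
    by apply: contra ni => xi'; rewrite (disj i i' x).
  by rewrite inE negbK => /eqP->; rewrite mulr0.
have colu i : chi (u i) = Some c by have [-> _ _] := wP (sg i); rewrite sgP.
have indu : lin_indep u.
  move=> a a0 i; have [_ _ ltc] := wP (sg i).
  have /card_gt0P [x xs] : (0 < #|supp (u i)|)%N by apply: leq_ltn_trans ltc.
  have := sumE a i x xs; rewrite a0 ffunE => /esym/eqP.
  by rewrite mulf_eq0; move: xs; rewrite inE => /negPf -> /[!orbF] /eqP.
have [a [c' [neq colw]]] := other_colour nmono indu colu.
have [i1 [i2 [ni a1 a2]]] := two_nonzero proj colu neq colw.
exists (\sum_i a i *: u i); split.
- by rewrite colw.
- move=> x; rewrite inE coord_sum => nz.
  have [i ui] : exists i, x \in supp (u i).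
    apply/existsP; apply: contraR nz => /existsPn H; rewrite big1 // => i _.
    by have := H i; rewrite inE negbK => /eqP->; rewrite mulr0.
  have [_ /(_ x ui) /andP [lx xl] _] := wP (sg i).
  apply/andP; split.
    apply: leq_trans lx; rewrite expnS mulnA leq_mul2r leq_addr orbT //.
  apply: leq_trans xl _; rewrite expnS mulnA leq_mul2r lt_block orbT //.
have sub i : a i != 0 -> supp (u i) \subset supp (\sum_i a i *: u i).
  move=> ai; apply/subsetP=> x xi; rewrite inE (sumE _ _ _ xi) mulf_neq0 //.
  by rewrite inE in xi.
have [_ _ lt1] := wP (sg i1); have [_ _ lt2] := wP (sg i2).
apply: (@leq_trans #|supp (u i1) :|: supp (u i2)|); last first.
  by apply: subset_leq_card; rewrite subUset !sub.
rewrite cardsU disjoint_setI0 ?cards0 ?subn0; last first.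
  rewrite disjoint_subset; apply/subsetP => x x1; rewrite inE.
  by apply: contra ni => x2; rewrite (disj i1 i2 x).
apply: leq_trans (leq_add lt1 lt2).
by rewrite addSn addnS ltnS ltnS leq_addr.
Qed.

(* The coordinate [None] carries the base point of the cube. *)
Definition cube (J : finType) (D : {set F})
    (chi : {ffun option J -> F^o} -> option C) c :=
  forall v : {ffun option J -> F^o},
    v None = 1 -> (forall j, v (Some j) \in D) -> chi v = Some c.

Lemma cube_start (J : finType) : exists I : finType,
  forall chi : {ffun I -> F^o} -> option C,
    projective chi -> ~ mono_flat chi -> unit_coloured chi ->
  exists (L : {ffun option J -> F^o} -> {ffun I -> F^o}) (c : C),
    lin_inj L /\ cube [set 0; 1] (chi \o L) c.
Proof.
pose d := ((k * #|C|).+1 ^ #|J|)%N.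
have [N HN] := grid_pigeonhole d {ffun {ffun 'I_d -> F} -> option C}.
exists ('I_d * 'I_N)%type => chi proj nmono ucol.
(* [I] consists of [d] blocks of [N] coordinates, and [G s w] puts the entry [w i] at position [s i]
   of block [i]. The colour of [s] records [chi (G s w)] for all [w] at once. *)
pose G (s : seq nat) (w : {ffun 'I_d -> F^o}) : {ffun 'I_d * 'I_N -> F^o} :=
  [ffun q => w q.1 * (nth 0%N s q.1 == nat_of_ord q.2)%:R].
have [P [szP ltP constP]] := HN (fun s => [ffun w => chi (G s w)]).
have lt_xy (i : 'I_d) : ((nth (0, 0) P i).1 < (nth (0, 0) P i).2 < N)%N.
  by apply: (allP ltP); rewrite mem_nth // szP.
have lt_y (i : 'I_d) : ((nth (0, 0) P i).2 < N)%N.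
  by have /andP [] := lt_xy i.
have lt_x (i : 'I_d) : ((nth (0, 0) P i).1 < N)%N.
  by have /andP [l1 l2] := lt_xy i; apply: ltn_trans l2.
pose x i := Ordinal (lt_x i); pose y i := Ordinal (lt_y i).
have neq_xy i : (x i == y i) = false.
  by have /andP [l1 _] := lt_xy i; apply/negbTE; rewrite -val_eqE /= ltn_eqF.
have selE h (i : 'I_d) : nth 0%N (select P h) i = if h i then y i else x i.
  by rewrite nth_mkseq ?szP //=; case: (h i).
have selP h w : chi (G (select P h) w) = chi (G (select P xpred0) w).
  by have /ffunP/(_ w) := constP h xpred0; rewrite !ffunE.
have G_inj : lin_inj (G (select P xpred0)).
  split=> [a u v|u u0].
    by apply/ffunP => q; rewrite !ffunE /GRing.scale /= mulrDl mulrA.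
  apply/ffunP => i; move/ffunP/(_ (i, x i)): u0.
  by rewrite !ffunE selE eqxx mulr1.
have ucolG : unit_coloured (chi \o G (select P xpred0)).
  move=> i; rewrite /=.
  suff -> : G (select P xpred0) (unit_vec i) = unit_vec (i, x i) by exact: ucol.
  apply/ffunP => -[i' j]; rewrite !ffunE selE -natrM mulnb xpair_eqE.
  by case: eqP => //= ->; rewrite eq_sym.
have projG := projective_pull G_inj proj.
have nmonoG : ~ mono_flat (chi \o G (select P xpred0)).
  by move/(mono_flat_pull G_inj).
have [|w [colw _ ltw]] :=
  @long_support d (chi \o G (select P xpred0)) #|J| 0 projG nmonoG ucolG.
  by rewrite mul1n.
pose sg (j : J) := enum_val (widen_ord (ltnW ltw) (enum_rank j)).
have sg_inj : injective sg.
  by move=> j j' /enum_val_inj /(congr1 val) /= /val_inj /enum_rank_inj.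
have sgw j : w (sg j) != 0.
  by have := enum_valP (widen_ord (ltnW ltw) (enum_rank j)); rewrite inE.
(* This is [v (Some j)] at the support coordinate [i = sg j] reserved for [j], and zero at
   coordinates reserved for no direction. *)
pose ct (v : {ffun option J -> F^o}) i : F^o := \sum_(j | sg j == i) v (Some j).
have ct_sg v j : ct v (sg j) = v (Some j).
  by rewrite /ct (big_pred1 j) // => j'; rewrite (inj_eq sg_inj).
(* Entry [i] of [w] is shared between the positions [x i] and [y i] with weights of sum [v None];
   weights 0 and 1 give the words [select P h]. *)
pose L (v : {ffun option J -> F^o}) : {ffun 'I_d * 'I_N -> F^o} :=
  [ffun q : 'I_d * 'I_N =>
  w q.1 * ((v None - ct v q.1) * (x q.1 == q.2)%:R + ct v q.1 * (y q.1 == q.2)%:R)].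
have [c colc] : exists c, chi (G (select P xpred0) w) = Some c.
  by move: colw => /=; case: (chi _) => [c|] // _; exists c.
exists L, c; split.
  split=> [a u v|u u0].
    apply/ffunP => -[i j]; rewrite !ffunE /=.
    have -> : ct (a *: u + v) i = a * ct u i + ct v i.
      rewrite /ct mulr_sumr -big_split /=.
      by apply: eq_bigr => j' _; rewrite !ffunE.
    by rewrite /GRing.scale /=; ring.
  have uS j : u (Some j) = 0.
    move/ffunP/(_ (sg j, y (sg j))): u0; rewrite !ffunE /= neq_xy eqxx.
    rewrite mulr0 add0r mulr1 ct_sg => /eqP.
    by rewrite mulf_eq0 (negPf (sgw j)) => /eqP.
  have ct0 i : ct u i = 0 by rewrite /ct big1.
  have /card_gt0P [i wi] : (0 < #|supp w|)%N by exact: leq_ltn_trans (leq0n _) ltw.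
  apply/ffunP => -[j|]; rewrite ffunE //.
  move/ffunP/(_ (i, x i)): u0; rewrite !ffunE /= eqxx eq_sym neq_xy ct0.
  rewrite mulr0 subr0 addr0 mulr1 => /eqP; rewrite inE in wi.
  by rewrite mulf_eq0 (negPf wi) => /eqP.
move=> v v1 v01 /=.
pose h (n : nat) := [exists j, (sg j == n :> nat) && (v (Some j) == 1)].
have ctE i : ct v i = (h i)%:R.
  case: (boolP [exists j, sg j == i]) => [/existsP [j /eqP <-]|/existsPn ni].
    rewrite ct_sg; have -> : h (sg j) = (v (Some j) == 1).
      apply/existsP/idP => [[j' /andP [/eqP/val_inj/sg_inj -> //]]|vj].
      by exists j; rewrite eqxx vj.
    have := v01 j; rewrite !inE => /orP [] /eqP -> //; last by rewrite eqxx.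
    by rewrite eq_sym oner_eq0.
  rewrite /ct big_pred0 => [|j]; last exact/negbTE/ni.
  have -> : h i = false.
    apply/existsP => -[j /andP [e _]]; by have := ni j; rewrite -val_eqE e.
  by [].
suff -> : L v = G (select P h) w by rewrite selP.
apply/ffunP => -[i j]; rewrite !ffunE /= selE ctE v1; congr (_ * _).
by case: (h i); rewrite /= ?subrr ?mul0r ?add0r ?mul1r // subr0 mul1r addr0.
Qed.

(** * Enlarging the coefficient set of a cube *)

Hypothesis prime_field : forall h y : F, h != 0 -> exists n, y = h *+ n.

Definition weighted_sumset (a : 'I_k -> F) (D : {set F}) : {set F} :=
  [set \sum_i a i * c i | c : {ffun 'I_k -> F} & [forall i, c i \in D]].

(* If two translates of a dilate of D coincide, then D is invariant under a
   nonzero translation, hence is the whole prime field. *)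
Lemma weighted_sumset_grow (a : 'I_k -> F) (D : {set F}) i1 i2 :
    i1 != i2 -> a i1 != 0 -> a i2 != 0 -> (1 < #|D|)%N ->
  weighted_sumset a D = setT \/ (#|D| < #|weighted_sumset a D|)%N.
Proof.
(* If [D] is the whole field, [a i1 != 0] alone makes the sumset the whole field. *)
move=> ni a1 a2 gtD; suff [DT|] : D = setT \/ (#|D| < #|weighted_sumset a D|)%N.
- left; apply/setP => y; rewrite [RHS]inE.
  apply/imsetP; exists [ffun i => if i == i1 then y / a i1 else 0].
    by rewrite inE; apply/forallP => i; rewrite DT inE.
  rewrite (bigD1 i1) //= big1 ?addr0 => [|i /negPf ii].
    by rewrite ffunE eqxx mulrC divfK.
  by rewrite ffunE ii mulr0.
- by right.
have /card_gt1P [d0 [d1 [D0 D1 nd]]] := gtD.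
case: (ltnP #|D| #|weighted_sumset a D|) => [|leD]; [by right | left].
pose r := \sum_(i | (i != i1) && (i != i2)) a i * d0.
pose f b x := a i1 * x + (a i2 * b + r).
have f_inj b : injective (f b) by move=> x y /addIr /(mulfI a1).
have fD b : b \in D -> f b @: D = weighted_sumset a D.
  move=> Db; apply/eqP; rewrite eqEcard card_imset // leD andbT.
  apply/subsetP => _ /imsetP [x Dx ->].
  apply/imsetP; exists [ffun i => if i == i1 then x else if i == i2 then b else d0].
    by rewrite inE; apply/forallP => i; rewrite ffunE; case: ifP => // _; case: ifP.
  rewrite (bigD1 i1) //= (bigD1 i2) 1?eq_sym //= !ffunE !eqxx.
  rewrite [i2 == i1]eq_sym (negPf ni); congr (_ + (_ + _)).
  by apply: eq_bigr => i /andP [/negPf n1 /negPf n2]; rewrite ffunE n1 n2.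
(* Chosen so that [f d1 x = f d0 (x + h)]. *)
pose h := a i2 * (d1 - d0) / a i1.
have h0 : h != 0 by rewrite !mulf_neq0 ?invr_eq0 // subr_eq0 eq_sym.
have Dh x : x \in D -> x + h \in D.
  move=> Dx; have : f d1 x \in f d0 @: D.
    by rewrite (fD d0) // -(fD d1) // imset_f.
  case/imsetP => x' Dx' e; suff -> : x + h = x' by [].
  apply: (mulfI a1); rewrite mulrDr /h mulrCA mulfV // mulr1.
  move: e; rewrite /f !addrA => /addIr e.
  by rewrite mulrBr addrA e addrK.
apply/setP => y; rewrite inE.
have [n yE] := prime_field (y - d0) h0.
rewrite -[y](subrK d0) yE addrC.
elim: n {yE} => [|n IH]; first by rewrite mulr0n addr0.
by rewrite mulrSr addrA Dh.
Qed.

(** A letter is a table with an entry for each direction in [J] and each of [k] points, so a word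
    encodes [k] points of the cube. On a line where the coefficients [a] and the new colour are
    constant, the moving letter runs over all tables, and the combination runs over a cube with
    directions [J] over the sumset. *)
Lemma cube_step (J : finType) : exists J' : finType,
  forall (chi : {ffun option J' -> F^o} -> option C) (D : {set F}) c,
    projective chi -> ~ mono_flat chi -> (1 < #|D|)%N -> cube D chi c ->
  exists (D' : {set F}) (c' : C)
         (L : {ffun option J -> F^o} -> {ffun option J' -> F^o}),
    [/\ lin_inj L, cube D' (chi \o L) c' & D' = setT \/ (#|D| < #|D'|)%N].
Proof.
pose T := {ffun J * 'I_k -> F}.
have [n Hn] := hales_jewett (enum {: T}) (option ({ffun 'I_k -> F} * C)%type).
(* The coordinates in ['I_k] only serve to keep the [k] chosen points of the
   cube linearly independent. *)
exists ('I_k + 'I_n * J)%type => chi D c proj nmono gtD cubeD.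
have /card_gt1P [d0 [d1 [D0 D1 nd]]] := gtD.
(* The alphabet is fixed before [D] is known, so letters take all values in [F] and are corrected to
   values in [D]. *)
pose pi x := if x \in D then x else d0.
have piD x : pi x \in D by rewrite /pi; case: ifP.
pose u (s : seq T) (i : 'I_k) : {ffun option ('I_k + 'I_n * J) -> F^o} :=
  [ffun q : option ('I_k + 'I_n * J) => match q return F^o with
   | None => 1
   | Some (inl j) => if i == j then d1 else d0
   | Some (inr (t, l)) => pi (nth 0 s t (l, i))
   end].
have colu s i : chi (u s i) = Some c.
  apply: cubeD => [|[j|[t l]]]; rewrite ffunE //; by case: ifP.
have sumR (a : 'I_k -> F) j : \sum_i a i * (if i == j then d1 else d0) =
    (\sum_i a i) * d0 + a j * (d1 - d0).
  rewrite mulr_suml (bigD1 j) //= [in RHS](bigD1 j) //= eqxx addrAC -mulrDr.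
  rewrite [d0 + _]addrC subrK; congr (_ + _).
  by apply: eq_bigr => i /negPf ->.
have indu s : lin_indep (u s).
  move=> a a0 j.
  have A0 : \sum_i a i = 0.
    move/ffunP/(_ None): a0; rewrite coord_sum ffunE => e; rewrite -[RHS]e.
    by apply: eq_bigr => i _; rewrite ffunE mulr1.
  move/ffunP/(_ (Some (inl j))): a0; rewrite coord_sum ffunE.
  under eq_bigr do rewrite ffunE.
  rewrite sumR A0 mul0r add0r => /eqP.
  by rewrite mulf_eq0 subr_eq0 [d1 == _]eq_sym (negPf nd) orbF => /eqP.
pose col s := [pick z : {ffun 'I_k -> F} * C |
  (z.2 != c) && (chi (\sum_i z.1 i *: u s i) == Some z.2)].
have [w [szw Nw line]] := Hn col.
pose t0 : T := 0.
have [a [c' [neq colE]]] : exists (a : {ffun 'I_k -> F}) c', c' != c /\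
    forall tau, chi (\sum_i a i *: u (fill tau w) i) = Some c'.
  case E : (col (fill t0 w)) => [[a c']|]; last first.
    have [a [c' [neq colE]]] := other_colour nmono (indu (fill t0 w)) (colu _).
    move: E; rewrite /col; case: pickP => // /(_ (a, c')) /=.
    by rewrite neq colE eqxx.
  exists a, c'.
  have E' tau : col (fill tau w) = Some (a, c').
    by rewrite -E; apply: line; rewrite mem_enum.
  split=> [|tau].
    by move: E; rewrite /col; case: pickP => // z /andP [zc _] [e]; rewrite e in zc.
  have := E' tau; rewrite /col; case: pickP => // z.
  by case/andP=> _ /eqP ze [e]; rewrite e in ze.
have [i1 [i2 [ni a1 a2]]] := two_nonzero proj (colu _) neq (colE t0).
pose A := \sum_i a i.
pose R j := \sum_i a i * (if i == j then d1 else d0).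
(* Fixed positions of [w] contribute to the base point; at moving positions stands the direction
   coordinate. *)
pose L (v : {ffun option J -> F^o}) : {ffun option ('I_k + 'I_n * J) -> F^o} :=
  [ffun q : option ('I_k + 'I_n * J) => match q return F^o with
   | None => v None * A
   | Some (inl j) => v None * R j
   | Some (inr (t, l)) =>
       if nth None w (nat_of_ord t) is Some tau
       then v None * \sum_i a i * pi (tau (l, i)) else v (Some l)
   end].
exists (weighted_sumset a D), c', L; split.
- split=> [b v v'|v v0].
    apply/ffunP => -[[j|[t l]]|]; rewrite !ffunE ?mulrDl -?mulrA //.
    by case: (nth None w t) => [tau|] //; rewrite mulrDl -mulrA.
  (* [A] may be zero, but [R i1] differs from a multiple of [A] by the nonzero
     [a i1 * (d1 - d0)]. *)
  have vN : v None = 0.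
    have vA : v None * A = 0 by move/ffunP/(_ None): v0; rewrite !ffunE.
    have vR : v None * R i1 = 0.
      by move/ffunP/(_ (Some (inl i1))): v0; rewrite !ffunE.
    move: vR; rewrite /R sumR mulrDr mulrA vA mul0r add0r => /eqP.
    by rewrite !mulf_eq0 (negPf a1) subr_eq0 [d1 == _]eq_sym (negPf nd) !orbF => /eqP.
  apply/ffunP => -[l|]; rewrite [RHS]ffunE //.
  have lt_i : (index None w < n)%N by rewrite -szw index_mem.
  move/ffunP/(_ (Some (inr (Ordinal lt_i, l)))): v0.
  by rewrite !ffunE /= nth_index.
- move=> v v1 vD /=.
  have /fin_all_exists [cc ccP] (l : J) : exists cl : {ffun 'I_k -> F},
      (forall i, cl i \in D) /\ v (Some l) = \sum_i a i * cl i.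
    by have /imsetP [cl] := vD l; rewrite inE => /forallP cD ->; exists cl.
  pose tau : T := [ffun q => cc q.1 q.2].
  rewrite -(colE tau); congr (chi _).
  apply/ffunP => q; rewrite coord_sum ffunE.
  under [RHS]eq_bigr do rewrite ffunE.
  case: q => [[j|[t l]]|]; rewrite ?v1 ?mul1r //; last first.
    by apply: eq_bigr => i _; rewrite mulr1.
  have ntE : nth 0 (fill tau w) t = odflt tau (nth None w t).
    by rewrite (nth_map None) // szw.
  rewrite ntE; case: (nth None w t) => [tau'|] /=; first by rewrite mul1r.
  have [cD ->] := ccP l; apply: eq_bigr => i _.
  by rewrite ffunE /= /pi cD.
exact: weighted_sumset_grow ni a1 a2 gtD.
Qed.

(** [r] bounds the number of field elements missing from [D]; each [cube_step] lowers this number or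
    fills the field. *)
Lemma cube_full r (J : finType) : exists J' : finType,
  forall (chi : {ffun option J' -> F^o} -> option C) (D : {set F}) c,
    projective chi -> ~ mono_flat chi -> (1 < #|D|)%N -> (#|F| <= #|D| + r)%N ->
    cube D chi c ->
  exists (L : {ffun option J -> F^o} -> {ffun option J' -> F^o}) (c' : C),
    lin_inj L /\ cube setT (chi \o L) c'.
Proof.
elim: r => [|r [J1 IH]].
  exists J => chi D c _ _ _; rewrite addn0 => leD cubeD; exists id, c.
  suff <- : D = setT by split=> //; split.
  by apply/eqP; rewrite eqEcard subsetT cardsT.
have [J2 step] := cube_step J1.
exists J2 => chi D c proj nmono gtD leD cubeD.
have [D' [c' [L [LL cubeL grow]]]] := step chi D c proj nmono gtD cubeD.
have nmonoL : ~ mono_flat (chi \o L) by move/(mono_flat_pull LL).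
have [||L' [c1 [LL' cubeL']]] :=
  IH (chi \o L) D' c' (projective_pull LL proj) nmonoL _ _ cubeL.
- case: grow => [->|ltD]; last exact: ltn_trans gtD ltD.
  by rewrite cardsT; apply: leq_trans gtD (max_card _).
- case: grow => [->|ltD]; first by rewrite cardsT leq_addr.
  by apply: leq_trans leD _; rewrite addnS -addSn leq_add2r.
by exists (L \o L'), c1; split; first exact: lin_inj_comp.
Qed.

Lemma affine_geometry (J : finType) : exists I : finType,
  forall chi : {ffun I -> F^o} -> option C,
    projective chi -> ~ mono_flat chi -> unit_coloured chi ->
  exists (L : {ffun option J -> F^o} -> {ffun I -> F^o}) (c : C),
    lin_inj L /\ forall v : {ffun option J -> F^o}, v None = 1 -> chi (L v) = Some c.
Proof.
have [J' full] := cube_full #|F| J.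
have [I start] := cube_start J'.
exists I => chi proj nmono ucol.
have [L [c [LL cubeL]]] := start chi proj nmono ucol.
have nmonoL : ~ mono_flat (chi \o L) by move/(mono_flat_pull LL).
have [||L' [c' [LL' cubeL']]] :=
  full _ _ _ (projective_pull LL proj) nmonoL _ _ cubeL.
- by rewrite cards2 eq_sym oner_eq0.
- by rewrite leq_addl.
exists (L \o L'), c'; split=> [|v v1]; first exact: lin_inj_comp.
by apply: cubeL' => // j; rewrite inE.
Qed.

(** * Flags of affine geometries *)

(** The condition on [v] says that its first nonzero coordinate is at [i], scaled to 1. By
    induction, the base point of an affine geometry is the first vector, and the others come from
    elements at infinity, where [v None = 0]. *)
Lemma flag_geometry r : exists I : finType,
  forall chi : {ffun I -> F^o} -> option C,
    projective chi -> ~ mono_flat chi -> unit_coloured chi ->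
  exists L : {ffun 'I_r -> F^o} -> {ffun I -> F^o}, lin_inj L /\
    forall i : 'I_r, exists c, forall v : {ffun 'I_r -> F^o},
      (forall j : 'I_r, (j < i)%N -> v j = 0) -> v i = 1 -> chi (L v) = Some c.
Proof.
elim: r => [|r [I1 IH]].
  exists void => chi _ _ _; exists (fun=> 0); split; last by case.
  split=> [a u v|u _]; first by rewrite scaler0 addr0.
  by apply/ffunP => -[].
have [I HI] := affine_geometry (I1 * 'I_k)%type.
exists I => chi proj nmono ucol.
have [L [c [LL Lc]]] := HI chi proj nmono ucol.
have projL := projective_pull LL proj.
pose inb (t : I1) (x : {ffun 'I_k -> F^o}) : {ffun option (I1 * 'I_k) -> F^o} :=
  [ffun q : option (I1 * 'I_k) => if q is Some (t', j) return F^o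
    then (t' == t)%:R * x j else 0].
(* Without an element in block [t], the base point shifted by the [k] unit directions of the block
   spans a monochromatic flat: vectors off infinity have colour [c], those at infinity are
   uncoloured. *)
have blockP t : exists x, chi (L (inb t x)) != None.
  case: (boolP [exists x : {ffun 'I_k -> F}, chi (L (inb t x)) != None]).
    by case/existsP => x xP; exists x.
  move=> /existsPn H; case: nmono; apply: (mono_flat_pull LL).
  pose u (i : 'I_k) : {ffun option (I1 * 'I_k) -> F^o} :=
    unit_vec None + inb t (unit_vec i).
  have sumS (a : 'I_k -> F) t' j :
      (\sum_i a i *: u i) (Some (t', j)) = (t' == t)%:R * a j :> F.
    rewrite coord_sum (bigD1 j) //= big1 ?addr0 => [|i ij].
      by rewrite !ffunE add0r eqxx mulr1 mulrC.
    by rewrite !ffunE add0r [j == i]eq_sym (negPf ij) !mulr0.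
  have sumN (a : 'I_k -> F) : (\sum_i a i *: u i) None = \sum_i a i :> F.
    rewrite coord_sum; apply: eq_bigr => i _.
    by rewrite !ffunE eqxx addr0 mulr1.
  have cu (v : {ffun option (I1 * 'I_k) -> F^o}) : v None != 0 -> chi (L v) = Some c.
    move=> vN; have [_ chiZ] := projL.
    rewrite -[chi _](chiZ (v None)^-1) ?invr_eq0 //=.
    by apply: Lc; rewrite ffunE /GRing.scale /= mulVf.
  exists u, c; split=> [a a0 j|i|a].
  - have := sumS a t j; rewrite a0 ffunE eqxx mul1r => <- //.
  - by apply: cu; rewrite !ffunE eqxx addr0 oner_eq0.
  rewrite /=; case: (eqVneq ((\sum_i a i *: u i) None) 0) => [s0|/cu ->]; last first.
    by rewrite !inE eqxx orbT.
  suff -> : \sum_i a i *: u i = inb t (finfun a).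
    by have := H (finfun a); rewrite negbK => /eqP ->.
  apply/ffunP => -[[t' j]|]; last by rewrite s0 ffunE.
  by rewrite sumS !ffunE.
have [x xP] := fin_all_exists blockP.
pose M (b : {ffun I1 -> F^o}) : {ffun option (I1 * 'I_k) -> F^o} :=
  [ffun q : option (I1 * 'I_k) => if q is Some (t, j) return F^o
    then b t * x t j else 0].
have M_inj : lin_inj M.
  split=> [a u v|u u0].
    apply/ffunP => -[[t j]|]; rewrite !ffunE; first by rewrite mulrDl -mulrA.
    by rewrite scaler0 addr0.
  apply/ffunP => t; rewrite [RHS]ffunE.
  have [j xj] : exists j, x t j != 0.
    apply/existsP; apply: contraR (xP t) => /existsPn x0.
    have -> : inb t (x t) = 0.
      apply/ffunP => -[[t' j]|]; rewrite !ffunE //.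
      by have := x0 j; rewrite negbK => /eqP->; rewrite mulr0.
    by have [/= -> _] := projL.
  move/ffunP/(_ (Some (t, j))): u0; rewrite !ffunE => /eqP.
  by rewrite mulf_eq0 (negPf xj) orbF => /eqP.
have LM_inj := lin_inj_comp LL M_inj.
have ucolLM : unit_coloured (chi \o (L \o M)).
  move=> t; rewrite /=; suff -> : M (unit_vec t) = inb t (x t) by exact: xP.
  apply/ffunP => -[[t' j]|]; rewrite !ffunE //.
  by case: eqP => [->|] //; rewrite !mul0r.
have nmonoLM : ~ mono_flat (chi \o (L \o M)) by move/(mono_flat_pull LM_inj).
have [G [GG HG]] := IH _ (projective_pull LM_inj proj) nmonoLM ucolLM.
pose tl (v : {ffun 'I_r.+1 -> F^o}) : {ffun 'I_r -> F^o} :=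
  [ffun i => v (lift ord0 i)].
pose e0 : {ffun option (I1 * 'I_k) -> F^o} := unit_vec None.
(* First coordinate 1 gives a point of the affine geometry, of colour [c]; first coordinate 0 leads
   to infinity, where [G] applies. *)
pose H (v : {ffun 'I_r.+1 -> F^o}) := (v ord0 : F) *: e0 + M (G (tl v)).
have HN v : H v None = v ord0.
  by rewrite !ffunE eqxx addr0 /GRing.scale /= mulr1.
have H_inj : lin_inj H.
  split=> [a u v|v v0].
    have tlD : tl (a *: u + v) = a *: tl u + tl v.
      by apply/ffunP => i; rewrite !ffunE.
    rewrite /H tlD (proj1 GG) (proj1 M_inj) !ffunE scalerDl scalerDr -!addrA.
    by rewrite scalerA; congr (_ + _); rewrite addrCA.
  have v00 : v ord0 = 0 by rewrite -HN v0 ffunE.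
  have : M (G (tl v)) = 0 by rewrite -v0 /H v00 scale0r add0r.
  move/(proj2 M_inj)/(proj2 GG)/ffunP => t0.
  apply/ffunP => i; rewrite [RHS]ffunE.
  by case: (unliftP ord0 i) => [j|] ->; rewrite ?v00 //; have := t0 j; rewrite !ffunE.
exists (L \o H); split; first exact: lin_inj_comp.
move=> i; case: (unliftP ord0 i) => [j|] ->.
  have [cj cjP] := HG j; exists cj => v v0 v1.
  have -> : (L \o H) v = (L \o M) (G (tl v)).
    by rewrite /= /H v0 // scale0r add0r.
  apply: cjP => [j' lt_j|]; rewrite ffunE //.
  by apply: v0; rewrite /= /bump /= !add1n ltnS.
by exists c => v _ v1; apply: Lc; rewrite HN.
Qed.

(** Among [r] indices, [k] share a colour. A nonzero combination of their unit vectors has its first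
    nonzero coordinate at one of them, hence has that colour. *)
Lemma mono_flat_exists : exists I : finType,
  forall chi : {ffun I -> F^o} -> option C,
    projective chi -> unit_coloured chi -> mono_flat chi.
Proof.
pose r := (k * #|C|).+1.
have [I HI] := flag_geometry r.
exists I => chi proj ucol; apply: NNPP => nmono; apply: (nmono).
have [L [LL HL]] := HI chi proj nmono ucol.
have [_ chiZ] := projective_pull LL proj.
have [col colP] := fin_all_exists HL.
have [c [sg [inj_sg sgP]]] : exists c, exists sg : 'I_k -> 'I_r,
    injective sg /\ forall i, col (sg i) = c.
  by apply: card_fiber; rewrite card_ord.
apply: (mono_flat_pull LL).
pose u (i : 'I_k) : {ffun 'I_r -> F^o} := unit_vec (sg i).
have sumE (a : 'I_k -> F) i : (\sum_i a i *: u i) (sg i) = a i :> F.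
  rewrite coord_sum (bigD1 i) //= big1 ?addr0 => [|j ji].
    by rewrite !ffunE eqxx mulr1.
  by rewrite !ffunE (inj_eq inj_sg) eq_sym (negPf ji) mulr0.
have spanP (a : 'I_k -> F) i : a i != 0 ->
    chi (L (\sum_i a i *: u i)) = Some c.
  move=> ai; pose v := \sum_i a i *: u i.
  have [j vj minj] := arg_minnP (P := fun j => v j != 0) (fun j : 'I_r => j : nat)
     (etrans (congr1 (fun x => x != 0) (sumE a i)) ai).
  have /existsP [i' /eqP sgi'] : [exists i', sg i' == j].
    apply: contraR vj => /existsPn nj.
    rewrite /v coord_sum big1 // => i' _.
    by rewrite !ffunE eq_sym (negPf (nj i')) mulr0.
  rewrite -[LHS](chiZ (v j)^-1) ?invr_eq0 //= -(sgP i') sgi'.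
  apply: colP => [j' lt_j|]; rewrite ffunE /GRing.scale /=; last exact: mulVf.
  case: (eqVneq (v j') 0) => [->|/minj]; first by rewrite mulr0.
  by rewrite leqNgt lt_j.
exists u, c; split=> [a a0 i|i|a].
- by rewrite -sumE a0 ffunE.
- rewrite /= -(sgP i); apply: colP => [j lt_j|]; rewrite ffunE ?eqxx //.
  by case: eqP lt_j => // ->; rewrite ltnn.
case: (boolP [exists i, a i != 0]) => [/existsP [i ai]|/existsPn a0].
  by rewrite /= (spanP a i) // !inE eqxx orbT.
have [proj0 _] := projective_pull LL proj.
rewrite big1 ?proj0 // => i _.
by have := a0 i; rewrite negbK => /eqP->; rewrite scale0r.
Qed.

End ColouredSpaces.

(** * Free families and spans indexed by a finite type *)

Section Families.

Variables (F : fieldType) (V : vectType F) (I : finType) (f : I -> V).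

Let X : #|I|.-tuple V := [tuple of [seq f i | i <- enum_tuple I]].

Let nthX (i : 'I_#|I|) : X`_i = f (enum_val i).
Proof.
rewrite /= (nth_map (enum_default i)) -?cardE //.
Qed.

Lemma sum_enum_tuple (a : I -> F) :
  \sum_i a i *: f i = \sum_(i < #|I|) a (enum_val i) *: X`_i.
Proof.
rewrite (reindex (@enum_val I I)) /=; last exact/onW_bij/enum_val_bij.
by apply: eq_bigr => i _; rewrite nthX.
Qed.

Lemma free_family : free [seq f i | i <- enum I] <->
  forall a : I -> F, \sum_i a i *: f i = 0 -> forall i, a i = 0.
Proof.
split=> [/(@freeP _ _ _ X) freeX a a0 i|H].
  by rewrite -(enum_rankK i); apply: (freeX (a \o enum_val)); rewrite -sum_enum_tuple.
apply/(@freeP _ _ _ X) => a a0 i; rewrite -(enum_valK i).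
apply: (H (a \o enum_rank)); rewrite sum_enum_tuple -[RHS]a0.
by apply: eq_bigr => j _; rewrite /= enum_valK.
Qed.

Lemma span_family w : w \in <<[seq f i | i <- enum I]>>%VS ->
  exists a : I -> F, w = \sum_i a i *: f i.
Proof.
move/(coord_span (X := X)) ->; exists (fun i => coord X (enum_rank i) w).
rewrite sum_enum_tuple; apply: eq_bigr => j _.
by rewrite enum_valK.
Qed.

End Families.

(** * Represented matroids *)

Section MatroidRank.

Variables (E : finType) (M : matroid E).

Lemma mrank_ge (I A : {set E}) : I \subset A -> indep M I -> (#|I| <= mrank M A)%N.
Proof.
move=> sIA indI.
by apply: (@leq_bigmax_cond _ _ (fun J : {set E} => #|J|)); rewrite sIA.
Qed.

Lemma mrank_witness (A : {set E}) :
  exists I : {set E}, [/\ I \subset A, indep M I & #|I| = mrank M A].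
Proof.
have [|I /andP [sIA indI] e] := @eq_bigmax_cond _
  (fun I : {set E} => (I \subset A) && indep M I) (fun I => #|I|).
  by apply/card_gt0P; exists set0; rewrite unfold_in sub0set indep0.
by exists I.
Qed.

Hypothesis simpleM : simple_matroid M.

Lemma mrank_set1 e : mrank M [set e] = 1%N.
Proof.
apply/eqP; rewrite eqn_leq; apply/andP; split.
  have [I [sI _ <-]] := mrank_witness [set e].
  by rewrite -(cards1 e) subset_leq_card.
by rewrite -(cards1 e); apply: mrank_ge => //; rewrite -[[set e]]setUid.
Qed.

Lemma mrank_gt1 (A : {set E}) e f :
  e \in A -> f \in A -> e != f -> (1 < mrank M A)%N.
Proof.
move=> Ae Af ef; apply: leq_trans (mrank_ge (I := [set e; f]) _ _) => //.
  by rewrite cards2 ef.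
by apply/subsetP => x; rewrite !inE => /orP [] /eqP ->.
Qed.

Lemma set1_rank_flat e : is_rank_flat M 1 [set e].
Proof.
rewrite /is_rank_flat mrank_set1 eqxx andbT; apply/eqP/setP => f.
rewrite !inE mrank_set1; case: (eqVneq f e) => [->|nf].
  by rewrite setUid mrank_set1.
apply/negbTE; rewrite neq_ltn; apply/orP; right.
by apply: (mrank_gt1 (e := f) (f := e)); rewrite // !inE eqxx ?orbT.
Qed.

Definition pt (e : E) : point M := exist _ [set e] (set1_rank_flat e).

Lemma pointP (P : point M) : exists e, P = pt e.
Proof.
case: P => P flatP; have /andP [_ /eqP rP] := flatP.
have [I [sIP _]] := mrank_witness P; rewrite rP => /eqP/cards1P [e Ie].
have Pe : e \in P by apply: (subsetP sIP); rewrite Ie set11.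
exists e; apply: val_inj; apply/eqP; rewrite /= eqEsubset sub1set Pe andbT.
apply/subsetP => f Pf; rewrite inE; apply: contraT => nf.
by have := mrank_gt1 Pf Pe nf; rewrite rP.
Qed.

Variables (F : fieldType) (n : nat) (v : E -> 'cV[F]_n).
Hypothesis reprM : forall I : {set E}, indep M I = free [seq v e | e <- enum I].

Definition vspan (A : {set E}) := <<[seq v e | e <- enum A]>>%VS.

Lemma vspan_mem (A : {set E}) e : e \in A -> v e \in vspan A.
Proof. by move=> Ae; apply/memv_span/map_f; rewrite mem_enum. Qed.

Lemma vspan_sub (A : {set E}) (W : {vspace 'cV[F]_n}) :
  (forall e, e \in A -> v e \in W) -> (vspan A <= W)%VS.
Proof.
by move=> H; apply/span_subvP => _ /mapP [e + ->]; rewrite mem_enum => /H.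
Qed.

Lemma vspanS (A B : {set E}) : A \subset B -> (vspan A <= vspan B)%VS.
Proof. by move=> /subsetP sAB; apply: vspan_sub => e /sAB /vspan_mem. Qed.

Lemma dim_vspan_indep (I : {set E}) : indep M I -> \dim (vspan I) = #|I|.
Proof. by rewrite reprM => /eqP ->; rewrite size_map -cardE. Qed.

(** A largest independent [I] inside [A] spans [vspan A], since an element of [A] outside [vspan I]
    would extend it. *)
Lemma mrank_dim (A : {set E}) : mrank M A = \dim (vspan A).
Proof.
have [I [sIA indI rI]] := mrank_witness A.
apply/eqP; rewrite eqn_leq -{1}rI -(dim_vspan_indep indI) dimvS ?vspanS //=.
rewrite -rI -(dim_vspan_indep indI); apply/dimvS/vspan_sub => e Ae.
apply: contraT => nIe.
have Ine : e \notin I by apply: contra nIe; apply: vspan_mem.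
have ind' : indep M (e |: I).
  rewrite reprM (perm_free (Y := v e :: [seq v e | e <- enum I])).
    by rewrite free_cons nIe -reprM.
  rewrite -[v e :: _]/[seq v e | e <- e :: enum I]; apply: perm_map.
  apply: uniq_perm; rewrite ?enum_uniq //= ?mem_enum ?Ine ?enum_uniq //.
  by move=> x; rewrite mem_enum !inE mem_enum.
have sub' : e |: I \subset A by rewrite subUset sub1set Ae.
by have := mrank_ge sub' ind'; rewrite cardsU1 Ine rI add1n ltnn.
Qed.

Lemma rep_neq0 e : v e != 0.
Proof.
have := dim_vspan_indep (simpleM e e); rewrite setUid cards1.
apply: contra_eq_neq => v0.
suff : (vspan [set e] <= 0)%VS by rewrite subv0 => /eqP ->; rewrite dimv0.
by apply: vspan_sub => f; rewrite inE => /eqP ->; rewrite v0 mem0v.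
Qed.

Lemma rep_parallel e f s : v e = s *: v f -> e = f.
Proof.
move=> vE; apply/eqP; apply: contraT => ef.
have := dim_vspan_indep (simpleM e f); rewrite cards2 ef => dim2.
have : (vspan [set e; f] <= <[v f]>)%VS.
  apply: vspan_sub => x; rewrite !inE => /orP [] /eqP ->; last exact: memv_line.
  by rewrite vE memvZ ?memv_line.
by move/dimvS; rewrite dim2 dim_vline; case: (_ == _).
Qed.

(** The premise makes the elements in [W] span it; adding an element then keeps the rank only if its
    vector lies in [W]. *)
Lemma span_rank_flat (W : {vspace 'cV[F]_n}) (A := [set e | v e \in W]) :
  (W <= vspan A)%VS -> is_rank_flat M (\dim W) A.
Proof.
move=> sWA.
have WE : vspan A = W.
  apply/eqP; rewrite eqEsubv sWA andbT.
  by apply: vspan_sub => e; rewrite inE.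
rewrite /is_rank_flat mrank_dim WE eqxx andbT; apply/eqP/setP => e.
rewrite [in LHS]inE !mrank_dim WE; apply/eqP/idP => [dimE|Ae].
  have /eqP eqW : W == vspan (e |: A).
    by rewrite eqEdim dimE leqnn andbT -{1}WE vspanS // subsetUr.
  by rewrite inE eqW vspan_mem // !inE eqxx.
suff -> : e |: A = A by rewrite WE.
by apply/setP => x; rewrite in_setU1; case: eqP => // ->.
Qed.

End MatroidRank.

(** * The colouring of vectors induced by a representation *)

Section RepresentationColouring.

Variables (E : finType) (M : matroid E) (F : finFieldType) (n : nat).
Variables (C : finType) (v : E -> 'cV[F]_n) (c : point M -> C).
Hypotheses (simpleM : simple_matroid M)
  (reprM : forall I : {set E}, indep M I = free [seq v e | e <- enum I]).

(** By simplicity at most one element qualifies, so [pick] makes no real choice. *)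
Definition vec_colour (x : 'cV[F]_n) : option C :=
  omap (c \o pt simpleM) [pick e | [exists s : F, (s != 0) && (x == s *: v e)]].

Lemma vec_colour_rep s e :
  s != 0 -> vec_colour (s *: v e) = Some (c (pt simpleM e)).
Proof.
move=> s0; rewrite /vec_colour; case: pickP => [f|/(_ e)] /=.
  case/existsP=> t /andP [t0 /eqP vE]; congr (Some (c (pt _ _))).
  apply/esym/(@rep_parallel _ _ simpleM _ _ _ reprM _ _ (s^-1 * t)).
  by rewrite -scalerA -vE scalerA mulVf // scale1r.
by move/negbT/existsPn/(_ s); rewrite s0 eqxx.
Qed.

Lemma vec_colourP x :
  (exists s e, s != 0 /\ x = s *: v e) \/ vec_colour x = None.
Proof.
rewrite /vec_colour; case: pickP => [e /existsP [s /andP [s0 /eqP xE]]|_].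
  by left; exists s, e.
by right.
Qed.

Lemma vec_colour_projective : projective vec_colour.
Proof.
split=> [|s x s0].
  case: (vec_colourP 0) => // -[s [e [s0 /esym/eqP]]].
  by rewrite scaler_eq0 (negPf s0) (negPf (rep_neq0 simpleM reprM e)).
rewrite /vec_colour; congr (omap _ _); apply: eq_pick => e.
apply/existsP/existsP => -[t /andP [t0 /eqP xE]].
  exists (s^-1 * t); rewrite mulf_neq0 ?invr_eq0 //=.
  by rewrite -scalerA -xE scalerA mulVf // scale1r.
by exists (s * t); rewrite mulf_neq0 //= xE scalerA.
Qed.

(** Each [u i] is coloured, hence a multiple of some [v e], so the elements in the span of the [u i]
    have rank [k]. Elements are never coloured [None], so all of them have colour [c0]. *)
Lemma mono_flat_matroid k : mono_flat k vec_colour ->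
  exists A : {set E}, is_rank_flat M k A /\ monochromatic c A.
Proof.
move=> [u [c0 [indu colu spanu]]].
pose W := <<[seq u i | i <- enum 'I_k]>>%VS.
have uW i : u i \in W by apply/memv_span/map_f; rewrite mem_enum.
have dimW : \dim W = k.
  have /free_family /eqP -> := indu.
  by rewrite size_map -cardE card_ord.
exists [set e | v e \in W]; split.
  rewrite -[X in is_rank_flat _ X]dimW; apply: (span_rank_flat reprM).
  apply/span_subvP => _ /mapP [i _ ->].
  case: (vec_colourP (u i)) => [[s [e [s0 uE]]]|]; last by rewrite colu.
  rewrite uE memvZ // vspan_mem // inE.
  by rewrite -[v e](scalerK s0) -uE memvZ.
suff col e : v e \in W -> c (pt simpleM e) = c0.
  move=> P Q; have [e ->] := pointP simpleM P; have [f ->] := pointP simpleM Q.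
  by rewrite /= !sub1set !inE => /col -> /col ->.
case/span_family => a vE; have := spanu a.
by rewrite -vE -[v e]scale1r vec_colour_rep ?oner_eq0 // !inE => /eqP [].
Qed.

End RepresentationColouring.

Lemma Fp_multiples p (h y : 'F_p) : h != 0 -> exists n, y = h *+ n.
Proof.
move=> h0; exists (nat_of_ord (y / h)).
by rewrite -mulr_natr natr_Zp mulrC divfK.
Qed.

Local Close Scope ring_scope.

Theorem corollary1p4 (p : nat) (hp : prime p) (k : nat) (hk : 1 <= k) :
  exists N : nat,
    forall (E : finType) (M : matroid E),
      simple_matroid M -> representable M 'F_p -> N <= matroid_rank M ->
      forall c : point M -> 'I_2,
        exists A : {set E}, is_rank_flat M k A /\ monochromatic c A.
Proof.
have [I HI] := mono_flat_exists 'I_2 k (@Fp_multiples p).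
(* This rank provides an independent element for each index in [I]; the map [L] below sends unit
   vectors to their vectors, which are coloured. *)
exists #|I| => E M simpleM [n [v reprM]] leI c.
have [B [_ indB cardB]] := mrank_witness M [set: E].
have {}leI : #|I| <= #|B| by rewrite cardB.
pose b (i : I) := enum_val (widen_ord leI (enum_rank i)).
have b_inj : injective b.
  by move=> i j /enum_val_inj /(congr1 val) /= /val_inj /enum_rank_inj.
have indb : lin_indep (v \o b).
  apply/free_family.
  have indbI : indep M (b @: I).
    apply: indepS indB; apply/subsetP => _ /imsetP [i _ ->]; exact: enum_valP.
  rewrite (perm_free (Y := [seq v e | e <- enum (b @: I)])) -?reprM //.
  rewrite (map_comp v b); apply: perm_map; apply: uniq_perm => [||e].
  - by rewrite (map_inj_uniq b_inj); exact: enum_uniq.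
  - exact: enum_uniq.
  rewrite mem_enum; apply/mapP/imsetP => -[i _ ->]; exists i => //.
  by rewrite mem_enum.
pose L (a : {ffun I -> ('F_p)^o}) := (\sum_i (a i : 'F_p) *: (v \o b) i)%R.
have L_inj : lin_inj L.
  split=> [s x y|x /indb x0]; last by apply/ffunP => i; rewrite x0 ffunE.
  rewrite /L scaler_sumr -big_split /=; apply: eq_bigr => i _.
  by rewrite !ffunE scalerDl scalerA.
apply: (mono_flat_matroid (simpleM := simpleM) reprM).
apply: (mono_flat_pull L_inj); apply: HI.
  exact: projective_pull L_inj (vec_colour_projective c simpleM reprM).
move=> i /=; have -> : L (unit_vec _ i) = (1 *: v (b i))%R.
  rewrite /L (bigD1 i) //= big1 => [|j /negPf ji].
    by rewrite ffunE eqxx addr0.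
  by rewrite ffunE ji scale0r.
by rewrite (vec_colour_rep _ _ reprM) ?oner_eq0.
Qed.
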